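(* Let $D$ be a radicable division ring with infinite center, let $n$ be a positive integer, and let $k$ be a positive integer. Then every matrix in $\mathrm{M}_n(D)$ can be expressed as a sum of two $k$-powers in $\mathrm{M}_n(D)$, and every matrix in $\mathrm{M}_n(D)$ can also be expressed as a product of two $k$-powers in $\mathrm{M}_n(D)$.
   Context: A division ring $D$ (commutative or not) is radicable if for every $a\in D$ and every positive integer $k$ the equation $x^k-a=0$ has a solution in $D$; equivalently, for every $a \in D\setminus\{0\}$ and every positive integer $k$ there is $b\in D\setminus\{0\}$ with $b^k=a$. $\mathrm{M}_n(D)$ is the ring of $n\times n$ matrices over $D$. A $k$-power in $\mathrm{M}_n(D)$ is an element of the form $B^k$ with $B\in\mathrm{M}_n(D)$. *)

(* Defs.v *)
From HB Require Import structures.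
From mathcomp Require Import all_boot all_order all_algebra.
From mathcomp Require Import classical_sets cardinality.

Set Implicit Arguments.
Unset Strict Implicit.
Unset Printing Implicit Defensive.

Import GRing.Theory.
Local Open Scope ring_scope.
Local Open Scope classical_set_scope.

(* A [unitRingType] is a nontrivial, possibly noncommutative ring in which
   [GRing.unit] is exactly the set of two-sided invertible elements. *)
Definition division_ring (D : unitRingType) : Prop :=
  forall x : D, x != 0 -> x \is a GRing.unit.

Definition ring_center (R : pzRingType) : set R :=
  [set z | forall x : R, GRing.comm z x].

Arguments ring_center R : clear implicits.

Definition is_power (R : pzRingType) (k : nat) (a : R) : Prop :=
  exists b : R, b ^+ k = a.

Definition radicable (D : unitRingType) : Prop :=
  forall (k : nat) (a : D), (0 < k)%N -> is_power k a.

(* Main.v *)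
Require Import Defs.
From mathcomp Require Import all_boot all_order all_fingroup all_algebra.
From mathcomp Require Import boolp classical_sets cardinality.

Set Implicit Arguments.
Unset Strict Implicit.
Unset Printing Implicit Defensive.

Import GRing.Theory.
Local Open Scope ring_scope.

(* A non-diagonal matrix is similar to one whose top left entry is any
   prescribed central [c]; taking [c = b + g] (resp. [c = b * g]) and
   decomposing the complementary block (resp. the Schur complement of [c])
   inductively gives A = P + Q (resp. A = P * Q) with P block lower and Q block
   upper triangular.  If the central corners [b], [g] are not among the
   eigenvalues of the smaller blocks, then P and Q are again diagonalizable,
   hence k-powers.  A diagonal matrix is split off a central scalar matrix.
   The induction carries a finite list of eigenvalues to be avoided, which is
   possible because the center is infinite. *)

(** * Similarity, its compatibility with sums, products and powers, and diagonalizability *)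

Section Similarity.
Context {R : nzRingType}.

Definition similar_mx {n} (A B : 'M[R]_n) : Prop :=
  exists T T', [/\ T *m T' = 1%:M, T' *m T = 1%:M & A = T *m B *m T'].

Lemma similar_mx_refl n (A : 'M[R]_n) : similar_mx A A.
Proof. by exists 1%:M, 1%:M; rewrite !mulmx1 mul1mx. Qed.

Lemma similar_mx_sym n (A B : 'M[R]_n) : similar_mx A B -> similar_mx B A.
Proof.
move=> [T [T' [TT' T'T ->]]]; exists T', T; split=> //.
by rewrite !mulmxA T'T mul1mx -mulmxA T'T mulmx1.
Qed.

Lemma similar_mx_trans n (A B C : 'M[R]_n) :
  similar_mx A B -> similar_mx B C -> similar_mx A C.
Proof.
move=> [T [T' [TT' T'T ->]]] [U [U' [UU' U'U ->]]].
exists (T *m U), (U' *m T'); split; rewrite !mulmxA //.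
  by rewrite -(mulmxA T) UU' mulmx1.
by rewrite -(mulmxA U') T'T mulmx1.
Qed.

Lemma similar_mx_add n (A P Q : 'M[R]_n) : similar_mx A (P + Q) ->
  exists P' Q', [/\ similar_mx P' P, similar_mx Q' Q & A = P' + Q'].
Proof.
move=> [T [T' [TT' T'T ->]]]; exists (T *m P *m T'), (T *m Q *m T').
by split; [exists T, T' | exists T, T' | rewrite mulmxDr mulmxDl].
Qed.

Lemma similar_mx_mul n (A P Q : 'M[R]_n) : similar_mx A (P *m Q) ->
  exists P' Q', [/\ similar_mx P' P, similar_mx Q' Q & A = P' *m Q'].
Proof.
move=> [T [T' [TT' T'T ->]]]; exists (T *m P *m T'), (T *m Q *m T').
split; [by exists T, T' | by exists T, T' |].
by rewrite !mulmxA -(mulmxA _ T' T) T'T mulmx1.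
Qed.

Lemma similar_mx_is_power n k (A B : 'M[R]_n) :
  similar_mx A B -> is_power k B -> is_power k A.
Proof.
move=> [T [T' [TT' T'T ->]]] [X <-]; exists (T *m X *m T').
elim: k => [|k IHk]; first by rewrite !expr0 mulmx1 TT'.
by rewrite !exprS IHk -!mulmxE !mulmxA -(mulmxA _ T' T) T'T mulmx1.
Qed.

Lemma diag_mx_exp n k (d : 'rV[R]_n) :
  diag_mx d ^+ k = diag_mx (\row_i d 0 i ^+ k).
Proof.
elim: k => [|k IHk].
  apply/matrixP=> i j; rewrite expr0 !mxE; case: eqP => // _.
rewrite exprS IHk -mulmxE mulmx_diag; congr diag_mx.
by apply/rowP=> i; rewrite !mxE exprS.
Qed.

Lemma mul_mx_central m n (A : 'M[R]_(m, n)) (c : R) :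
  ring_center R c -> A *m c%:M = c *: A.
Proof.
move=> cC; apply/matrixP=> i j.
by rewrite -diag_const_mx mul_mx_diag !mxE cC.
Qed.

(** Over a noncommutative ring the diagonal entries are determined only up to conjugation, so
    avoidance of [F] refers to one chosen diagonal form. *)
Definition diagonalizable_avoiding (F : seq R) {n} (A : 'M[R]_n) : Prop :=
  exists2 d, similar_mx A (diag_mx d) & forall i, d 0 i \notin F.

Lemma diagonalizable_avoiding_similar F n (A B : 'M[R]_n) :
  similar_mx A B -> diagonalizable_avoiding F B -> diagonalizable_avoiding F A.
Proof. by move=> AB [d Bd dF]; exists d => //; apply: similar_mx_trans Bd. Qed.

Lemma diagonalizable_avoiding_sub (F G : seq R) n (A : 'M[R]_n) :
  {subset F <= G} -> diagonalizable_avoiding G A -> diagonalizable_avoiding F A.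
Proof.
by move=> FG [d Ad dG]; exists d => // i; apply: contra (dG i) => /FG.
Qed.

Lemma diagonalizable_diag_mx (F : seq R) n (d : 'rV[R]_n) :
  (forall i, d 0 i \notin F) -> diagonalizable_avoiding F (diag_mx d).
Proof. by exists d => //; apply: similar_mx_refl. Qed.

End Similarity.

(** * Corner entries and block triangular matrices over a division ring *)

Section DivisionRing.
Context {D : unitRingType} (divD : division_ring D).

(** A transposition moves a nonzero off-diagonal entry into the first row. Conjugation by a
    unipotent block matrix with lower left block [x] then subtracts [u x] from the corner, [u] being
    the rest of that row; as [u] is nonzero, [u x] takes every value. *)
Lemma similar_mx_corner n (A : 'M[D]_(1 + n)) (c : D) : ~~ is_diag_mx A ->
  exists u w S, similar_mx A (block_mx c%:M u w S).
Proof.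
move=> /is_diag_mxP/existsNP [i] /existsNP [j].
move=> /not_implyP [neq_ij /eqP Aij0].
pose s : {perm 'I_(1 + n)} := tperm 0 i.
have [B AB BE] : exists2 B, similar_mx A B & forall l m, B l m = A (s l) (s m).
  exists (perm_mx s *m A *m perm_mx s^-1%g); last first.
    by move=> l m; rewrite -row_permE -col_permE !mxE.
  apply: similar_mx_sym; exists (perm_mx s), (perm_mx s^-1%g).
  by rewrite -!perm_mxM mulgV mulVg perm_mx1.
(* The entry [A i j] sits in [B] at row [0] and column [s j], which is not [0] because [j] differs
   from [i]. *)
have [h uh0] : exists h, ursubmx B 0 h != 0.
  have : s j != 0 by rewrite -[0](tpermR 0 i) (inj_eq perm_inj) eq_sym.
  case: (split_ordP (s j : 'I_(1 + n))) => [l sj | h sj] sj0.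
    by case/eqP: sj0; rewrite sj; apply: val_inj; rewrite /= ord1.
  exists h; rewrite !mxE -sj BE tpermK.
  by rewrite (_ : lshift n 0 = 0) ?tpermL //; apply: val_inj.
pose x : 'cV[D]_n :=
  \col_l if l == h then (ursubmx B 0 h)^-1 * (B 0 0 - c) else 0.
have ux : (ursubmx B *m x) 0 0 = B 0 0 - c.
  rewrite mxE (bigD1 h) //= [x _ _]mxE eqxx mulrA divrr ?divD // mul1r.
  by rewrite big1 ?addr0 // => l /negPf lh; rewrite [x _ _]mxE lh mulr0.
pose T : 'M[D]_(1 + n) := block_mx 1%:M 0 x 1%:M.
pose T' : 'M[D]_(1 + n) := block_mx 1%:M 0 (- x) 1%:M.
have TT' : T *m T' = 1%:M.
  rewrite mulmx_block !mulmx0 !mul0mx !mulmx1 !mul1mx !addr0 add0r subrr.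
  by rewrite -scalar_mx_block.
have T'T : T' *m T = 1%:M.
  rewrite mulmx_block !mulmx0 !mul0mx !mulmx1 !mul1mx !addr0 add0r addNr.
  by rewrite -scalar_mx_block.
pose C := T *m B *m T'.
exists (ursubmx C), (dlsubmx C), (drsubmx C).
apply: similar_mx_trans AB _; apply: similar_mx_sym; exists T, T'; split=> //.
rewrite -[RHS]submxK; congr block_mx.
rewrite -/C /C -{1}[B]submxK !mulmx_block block_mxKul.
rewrite !mul1mx !mul0mx !addr0 mulmx1 mulmxN.
apply/matrixP=> l m; rewrite !ord1 [RHS]mxE [X in _ + X]mxE ux opprB.
rewrite !mxE eqxx mulr1n (_ : lshift n 0 = 0); last exact: val_inj.
by rewrite addrC subrK.
Qed.

(** Removing [w] by a unipotent conjugation amounts to solving [x f - d x = T' w]. Since [f] is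
    central this splits into the equations [(f - d_i) x_i = (T' w)_i], solvable because no [d_i]
    equals [f]. *)
Lemma diagonalizable_block_lower F f n (w : 'cV[D]_n) (P : 'M[D]_n) :
    ring_center D f -> f \notin F -> diagonalizable_avoiding (f :: F) P ->
  diagonalizable_avoiding F (block_mx f%:M 0 w P).
Proof.
move=> fC fF [d [T [T' [TT' T'T ->]]] dfF].
exists (row_mx (const_mx f) d); last first.
  move=> i; case: (split_ordP i) => h ->; first by rewrite row_mxEl mxE.
  by rewrite row_mxEr; have:= dfF h; rewrite inE negb_or => /andP[].
pose x : 'cV[D]_n := \col_i ((f - d 0 i)^-1 * (T' *m w) i 0).
have xE : f *: x - diag_mx d *m x = T' *m w.
  apply/colP=> i; rewrite mul_diag_mx !mxE -!mulrBl mulrA divrr ?mul1r ?mxE //.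
  apply: divD; rewrite subr_eq0 eq_sym.
  by have:= dfF i; rewrite inE negb_or => /andP[].
exists (block_mx 1%:M 0 (T *m x) T), (block_mx 1%:M 0 (- x) T').
rewrite diag_mx_row diag_const_mx !mulmx_block.
rewrite !mulmx0 !mul0mx !mulmx1 !mul1mx !addr0 !add0r.
rewrite TT' T'T mulmxN subrr mulmxA T'T mul1mx addNr -!scalar_mx_block.
split=> //; congr block_mx; rewrite ?mul0mx ?addr0 //.
rewrite -[T *m x *m _]mulmxA mul_mx_central //.
by rewrite mulmxN -(mulmxA T) -mulmxBr xE mulmxA TT' mul1mx.
Qed.

Lemma diagonalizable_block_upper F f n (u : 'rV[D]_n) (P : 'M[D]_n) :
    ring_center D f -> f \notin F -> diagonalizable_avoiding (f :: F) P ->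
  diagonalizable_avoiding F (block_mx f%:M u 0 P).
Proof.
move=> fC fF [d [T [T' [TT' T'T ->]]] dfF].
exists (row_mx (const_mx f) d); last first.
  move=> i; case: (split_ordP i) => h ->; first by rewrite row_mxEl mxE.
  by rewrite row_mxEr; have:= dfF h; rewrite inE negb_or => /andP[].
(* The equation is now [x d - f x = u T]; centrality of [f] puts the factor [d_i - f] on the right
   of [x_i]. *)
pose x : 'rV[D]_n := \row_i ((u *m T) 0 i * (d 0 i - f)^-1).
have xE : x *m diag_mx d - f *: x = u *m T.
  apply/rowP=> i; rewrite mul_mx_diag !mxE fC -mulrBr -mulrA mulVr ?mulr1 //.
  apply: divD; rewrite subr_eq0.
  by have:= dfF i; rewrite inE negb_or => /andP[].
exists (block_mx 1%:M x 0 T), (block_mx 1%:M (- (x *m T')) 0 T').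
rewrite diag_mx_row diag_const_mx !mulmx_block.
rewrite !mulmx0 !mul0mx !mulmx1 !mul1mx !addr0 !add0r.
rewrite addNr mulNmx -(mulmxA x) TT' T'T mulmx1 subrr -!scalar_mx_block.
split=> //; rewrite mul0mx add0r; congr block_mx.
by rewrite mulmxN mul_scalar_mx addrC scalemxAl -mulmxBl xE -mulmxA TT' mulmx1.
Qed.

End DivisionRing.

(** * Sums and products of two diagonalizable matrices *)

Section InfiniteCenter.
Context {D : unitRingType} (divD : division_ring D).
Context (infZ : infinite_set (ring_center D)).

Lemma exists_central_notin (s : seq D) :
  exists2 z, ring_center D z & z \notin s.
Proof.
apply: contrapT => nz; apply: infZ.
apply: (sub_finite_set _ (finite_seq s)) => z zC /=.
by apply: contrapT => /negP zs; apply: nz; exists z.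
Qed.

Lemma sum_diag_mx n (d : 'rV[D]_n) (F : seq D) :
  exists P Q, [/\ diagonalizable_avoiding F P, diagonalizable_avoiding F Q
                & diag_mx d = P + Q].
Proof.
(* The entry [d_i - z] equals some [f] in [F] only if [z = d_i - f], so finitely many values of [z]
   are excluded. *)
have [z _] := exists_central_notin
  (F ++ [seq d 0 i - f | i <- enum 'I_n, f <- F]).
rewrite mem_cat negb_or => /andP[zF zdF].
exists (diag_mx (const_mx z)), (diag_mx (\row_i (d 0 i - z))); split.
- by apply: diagonalizable_diag_mx => i; rewrite mxE.
- apply: diagonalizable_diag_mx => i; rewrite mxE.
  apply: contra zdF => dzF; apply/allpairsP; exists (i, d 0 i - z).
  by rewrite mem_enum /= subKr.
- by rewrite -raddfD; congr diag_mx; apply/rowP=> i; rewrite !mxE addrC subrK.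
Qed.

Lemma sum_diagonalizable n (A : 'M[D]_n) (F : seq D) :
  exists P Q, [/\ diagonalizable_avoiding F P, diagonalizable_avoiding F Q
                & A = P + Q].
Proof.
elim: n A F => [|n IHn] A F.
  by rewrite [A]flatmx0 -(raddf0 (@diag_mx D 0)); apply: sum_diag_mx.
have [/diag_mxP[d ->] | nA] := boolP (is_diag_mx A); first exact: sum_diag_mx.
have [b bC bF] := exists_central_notin F.
have [g gC gF] := exists_central_notin F.
have [u [w [S AS]]] := similar_mx_corner divD (b + g) nA.
(* [P] must avoid [b] and [Q] must avoid [g]; one list serves both. *)
have [P [Q [Pd Qd SE]]] := IHn S (b :: g :: F).
have AE : block_mx (b + g)%:M u w S
        = block_mx b%:M 0 w P + block_mx g%:M u 0 Q.
  by rewrite add_block_mx add0r addr0 -raddfD -SE.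
rewrite AE in AS.
have [P' [Q' [P'P Q'Q ->]]] := similar_mx_add AS.
exists P', Q'; split=> //.
  apply: diagonalizable_avoiding_similar P'P _.
  apply: diagonalizable_block_lower => //.
  apply: diagonalizable_avoiding_sub Pd => x.
  by rewrite !inE => /orP[] ->; rewrite ?orbT.
apply: diagonalizable_avoiding_similar Q'Q _.
apply: diagonalizable_block_upper => //.
apply: diagonalizable_avoiding_sub Qd => x.
by rewrite !inE => ->; rewrite orbT.
Qed.

(** A zero entry of [d] stays zero in the factor [z^-1 d], whence the condition on [F]. An entry
    [z^-1 d_i] lying in [F] is therefore invertible and forces [z = d_i / f]. *)
Lemma product_diag_mx n (d : 'rV[D]_n) (F : seq D) : 0 \notin F ->
  exists P Q, [/\ diagonalizable_avoiding F P, diagonalizable_avoiding F Q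
                & diag_mx d = P *m Q].
Proof.
move=> F0; have [z _] := exists_central_notin
  (0 :: F ++ [seq d 0 i / f | i <- enum 'I_n, f <- F]).
rewrite inE mem_cat !negb_or => /and3P[z0 zF zdF].
exists (diag_mx (const_mx z)), (diag_mx (\row_i (z^-1 * d 0 i))); split.
- by apply: diagonalizable_diag_mx => i; rewrite mxE.
- apply: diagonalizable_diag_mx => i; rewrite mxE.
  apply: contra zdF => dzF; apply/allpairsP; exists (i, z^-1 * d 0 i).
  rewrite mem_enum /=; split=> //.
  have zd0 : z^-1 * d 0 i \is a GRing.unit.
    by apply: divD; apply: contraNneq F0 => <-.
  by apply: (mulIr zd0); rewrite mulrVK // mulrA divrr ?mul1r ?divD.
- rewrite mulmx_diag; congr diag_mx; apply/rowP=> i.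
  by rewrite !mxE mulrA divrr ?mul1r ?divD.
Qed.

Lemma product_diagonalizable n (A : 'M[D]_n) (F : seq D) : 0 \notin F ->
  exists P Q, [/\ diagonalizable_avoiding F P, diagonalizable_avoiding F Q
                & A = P *m Q].
Proof.
elim: n A F => [|n IHn] A F F0.
  by rewrite [A]flatmx0 -(raddf0 (@diag_mx D 0)); apply: product_diag_mx.
have [/diag_mxP[d ->] | nA] := boolP (is_diag_mx A).
  exact: product_diag_mx.
(* Corners are taken nonzero, both to be inverted and to keep [0] off the enlarged list. *)
have [b bC] := exists_central_notin (0 :: F).
rewrite inE negb_or => /andP[b0 bF].
have [g gC] := exists_central_notin (0 :: F).
rewrite inE negb_or => /andP[g0 gF].
have [u [w [S AS]]] := similar_mx_corner divD (b * g) nA.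
have bgF0 : 0 \notin b :: g :: F.
  by rewrite !inE !negb_or (eq_sym 0) b0 (eq_sym 0) g0.
(* The lower right block of the product below is [w g^-1 b^-1 u + P Q], so [P Q] has to be the Schur
   complement of [b * g]. *)
have [P [Q [Pd Qd SE]]] :=
  IHn (S - w *m (g^-1 *: (b^-1 *: u))) (b :: g :: F) bgF0.
have AE : block_mx (b * g)%:M u w S
        = block_mx b%:M 0 (w *m g^-1%:M) P *m block_mx g%:M (b^-1 *: u) 0 Q.
  rewrite mulmx_block !mulmx0 !mul0mx !addr0 -SE -!mulmxA.
  rewrite -!scalar_mxM mulVr ?divD // mulmx1 !mul_scalar_mx scalerA.
  by rewrite [in RHS]addrC subrK scalerA divrr ?divD // scale1r.
rewrite AE in AS.
have [P' [Q' [P'P Q'Q ->]]] := similar_mx_mul AS.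
exists P', Q'; split=> //.
  apply: diagonalizable_avoiding_similar P'P _.
  apply: diagonalizable_block_lower => //.
  apply: diagonalizable_avoiding_sub Pd => x.
  by rewrite !inE => /orP[] ->; rewrite ?orbT.
apply: diagonalizable_avoiding_similar Q'Q _.
apply: diagonalizable_block_upper => //.
apply: diagonalizable_avoiding_sub Qd => x.
by rewrite !inE => ->; rewrite orbT.
Qed.

End InfiniteCenter.

Lemma diagonalizable_is_power (D : unitRingType) F n k (A : 'M[D]_n) :
    radicable D -> (0 < k)%N -> diagonalizable_avoiding F A -> is_power k A.
Proof.
move=> radD k_gt0 [d Ad _]; apply: similar_mx_is_power Ad _.
(* Radicability gives a root of each diagonal entry, and powers of diagonal matrices are
   entrywise. *)
have /choice [r rP] : forall i, exists b, b ^+ k = d 0 i.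
  by move=> i; apply: radD.
exists (diag_mx (\row_i r i)); rewrite diag_mx_exp; congr diag_mx.
by apply/rowP=> i; rewrite !mxE.
Qed.

Theorem theorem4p1 (D : unitRingType) (n k : nat)
  (divD : division_ring D)
  (radD : radicable D)
  (infZ : infinite_set (ring_center D))
  (n_gt0 : (0 < n)%N)
  (k_gt0 : (0 < k)%N) :
  (forall A : 'M[D]_n,
     exists P Q : 'M[D]_n, [/\ is_power k P, is_power k Q & A = P + Q]) /\
  (forall A : 'M[D]_n,
     exists P Q : 'M[D]_n, [/\ is_power k P, is_power k Q & A = P *m Q]).
Proof.
split=> A.
  have [P [Q [Pd Qd AE]]] := sum_diagonalizable divD infZ A [::].
  by exists P, Q; split; [exact: diagonalizable_is_power Pd
                         | exact: diagonalizable_is_power Qd |].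
have [P [Q [Pd Qd AE]]] := product_diagonalizable divD infZ A (F := [::]) isT.
by exists P, Q; split; [exact: diagonalizable_is_power Pd
                       | exact: diagonalizable_is_power Qd |].
Qed.
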